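(* Let $U=\{1,\dots,n\}$, $n\ge2$, with distance function $d$ and continuation probabilities $p_i\in[a,b]$ for all $i\in U$, where $0<a\le b<1$. Then the greedy algorithm provides a $\frac{a^2(1-b)^2}{a^2+b^2}$-approximation guarantee for MaxOHP. That is, for any ordering $O$ output by the greedy algorithm, $$\mathcal{H}(O)\ \ge\ \frac{a^2(1-b)^2}{a^2+b^2}\,\max_{O'}\mathcal{H}(O'),$$ the maximum being over all orderings $O'$ of $U$.
   Context: The distance function $d:U\times U\to\mathbb{R}_{\ge0}$ is symmetric with $d(i,i)=0$. For a sequence $O=(\pi(1),\dots,\pi(m))$ of distinct items, let $O_k=(\pi(1),\dots,\pi(k))$ and $p_{O_k}=\prod_{t=1}^kp_{\pi(t)}$. For an ordering $O$ of $U$ the ordered Hamiltonian path objective is $\mathcal{H}(O)=\sum_{i=1}^{n-1}W_{O_i}\,d(\pi(i),\pi(i+1))$ with $W_{O_i}=\sum_{j=i+1}^np_{O_j}$. MaxOHP asks for an ordering of $U$ maximizing $\mathcal{H}$. For a sequence $O=(\pi(1),\dots,\pi(m))$ the sequential sum diversity is $\mathcal{S}_+(O)=\sum_{i=1}^{m-1}p_{O_{i+1}}\sum_{t=1}^{i}d(\pi(i+1),\pi(t))$. Greedy algorithm: choose $O_2=(\pi(1),\pi(2))$ to be a pair of distinct items maximizing $p_{\pi(1)}p_{\pi(2)}d(\pi(1),\pi(2))$; then for $t=2,\dots,n-1$ append to $O_t$ an item $u\in U\setminus O_t$ maximizing $\mathcal{S}_+(O_t\|v)-\mathcal{S}_+(O_t)$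 over $v\in U\setminus O_t$ (where $\|$ is concatenation), obtaining $O_{t+1}=O_t\|u$. Output $O_n$. Ties are broken arbitrarily. *)

(* Defs.v *)
(* [R : realType] plays the role of the real numbers. *)
From HB Require Import structures.
From mathcomp Require Import all_boot all_order all_algebra.
From mathcomp Require Import reals.

Set Implicit Arguments.
Unset Strict Implicit.
Unset Printing Implicit Defensive.

Import Order.TTheory GRing.Theory Num.Theory.
Local Open Scope ring_scope.

Section SequentialDiversity.
Variables (R : realType) (T : eqType) (d : T -> T -> R) (p : T -> R).
Implicit Types (O : seq T) (i j k : nat).

(* A sequence O = (pi(1), ..., pi(m)) is a [seq T], but positions i, j, k below
   are counted from 1, whence the shifts by one.  [dist_at O i j] is
   d(pi(i), pi(j)) for 1 <= i, j <= m; it is only used in that range, so the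
   default value of [nth] never matters. *)
Definition dist_at O i j : R :=
  if O is x0 :: _ then d (nth x0 O i.-1) (nth x0 O j.-1) else 0.

(* p_{O_k} *)
Definition prefix_prob O k : R := \prod_(x <- take k O) p x.

(* W_{O_i} = \sum_{j = i+1}^{m} p_{O_j}, where m is the length of O *)
Definition ohp_weight O i : R :=
  \sum_(i.+1 <= j < (size O).+1) prefix_prob O j.

(* The objective H *)
Definition ohp O : R :=
  \sum_(1 <= i < size O) ohp_weight O i * dist_at O i i.+1.

(* The sequential sum diversity S_+ *)
Definition seq_sum_div O : R :=
  \sum_(1 <= i < size O)
     prefix_prob O i.+1 * \sum_(1 <= t < i.+1) dist_at O i.+1 t.

(* The sequences the greedy algorithm may hold at some stage; ties are broken
   arbitrarily, so this is a relation rather than a function. *)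
Inductive greedy_run : seq T -> Prop :=
| GreedyPair (x y : T) :
    x != y ->
    (forall x' y' : T, x' != y' -> p x' * p y' * d x' y' <= p x * p y * d x y) ->
    greedy_run [:: x; y]
| GreedyAppend (O : seq T) (u : T) :
    greedy_run O ->
    u \notin O ->
    (forall v : T, v \notin O ->
       seq_sum_div (rcons O v) - seq_sum_div O
         <= seq_sum_div (rcons O u) - seq_sum_div O) ->
    greedy_run (rcons O u).

End SequentialDiversity.

Section Orderings.
Variables (R : realType) (n : nat) (d : 'I_n -> 'I_n -> R) (p : 'I_n -> R).

(* The run stops once all n items have been placed. *)
Definition greedy_output (O : seq 'I_n) : Prop :=
  greedy_run d p O /\ size O = n.

(* The maximum of H over all orderings of U = 'I_n, i.e. over the n-tuples of
   pairwise distinct items.  The seed of the iterated maximum is the value of H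
   at the identity ordering, so it does not affect the result. *)
Definition max_ohp : R :=
  \big[Num.max/ohp d p (enum 'I_n)]_(O : n.-tuple 'I_n | uniq O) ohp d p O.

End Orderings.

(* Main.v *)
(** The first pair chosen by the greedy algorithm is already good enough.  Let
    M be the maximal value of p_x p_y d(x, y).  For any ordering O', bounding
    continuation probabilities by b gives W_{O'_i} <= p_{O'_{i+1}} / (1 - b),
    and p_{O'_{i+1}} d(pi'(i), pi'(i+1)) <= b^{i-1} M, so that
    H(O') <= M / (1 - b)^2.  The first summand of H for the greedy ordering is
    at least M.  This yields the factor (1 - b)^2, and a^2 / (a^2 + b^2) <= 1. *)
Require Import Defs.
From HB Require Import structures.
From mathcomp Require Import all_boot all_order all_algebra.
From mathcomp Require Import reals.

Set Implicit Arguments.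
Unset Strict Implicit.
Unset Printing Implicit Defensive.

Import Order.TTheory GRing.Theory Num.Theory.
Local Open Scope ring_scope.

(** The product telescopes to [1 - b ^+ m]. *)
Lemma geometric_sum_le1 (R : realDomainType) (b : R) (m : nat) :
  0 <= b -> (1 - b) * \sum_(i < m) b ^+ i <= 1.
Proof.
move=> b_ge0; rewrite -opprB mulNr -subrX1 opprB.
by rewrite lerBlDr lerDl exprn_ge0.
Qed.

Section FirstPair.
Variables (R : realType) (T : eqType) (d : T -> T -> R) (p : T -> R).
Hypothesis d_ge0 : forall x y, 0 <= d x y.
Hypothesis p_ge0 : forall x, 0 <= p x.
Implicit Types (O : seq T) (i j k : nat).

Lemma prefix_prob_ge0 O k : 0 <= prefix_prob p O k.
Proof. exact: prodr_ge0. Qed.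

Lemma dist_at_ge0 O i j : 0 <= dist_at d O i j.
Proof. by case: O => /=. Qed.

Lemma ohp_weight_ge0 O i : 0 <= ohp_weight p O i.
Proof. by apply: sumr_ge0 => j _; exact: prefix_prob_ge0. Qed.

Lemma prefix_probS x0 O k : (k < size O)%N ->
  prefix_prob p O k.+1 = prefix_prob p O k * p (nth x0 O k).
Proof.
by move=> ltk; rewrite /prefix_prob (take_nth x0 ltk) -cats1 big_cat big_seq1.
Qed.

Lemma prefix_prob_le_ohp_weight O i : (i < size O)%N ->
  prefix_prob p O i.+1 <= ohp_weight p O i.
Proof.
move=> lti; rewrite /ohp_weight big_ltn // lerDl.
by apply: sumr_ge0 => j _; exact: prefix_prob_ge0.
Qed.

Lemma first_pair_le_ohp x y O :
  p x * p y * d x y <= ohp d p [:: x, y & O].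
Proof.
(* Only the summand at position 1 is kept, and of its weight only the leading term, which is
   [p x * p y]. *)
rewrite /ohp big_ltn // -[leLHS]addr0 lerD //; last first.
  by apply: sumr_ge0 => i _; rewrite mulr_ge0 ?ohp_weight_ge0 ?dist_at_ge0.
apply: ler_wpM2r => //; apply: le_trans (prefix_prob_le_ohp_weight _) => //.
by rewrite /prefix_prob /= take0 !big_cons big_nil mulr1.
Qed.

(** Later steps append at the end, so the initial pair stays at the head. *)
Lemma greedy_run_first_pair O : greedy_run d p O ->
  exists x y O', O = [:: x, y & O'] /\
    forall x' y', x' != y' -> p x' * p y' * d x' y' <= p x * p y * d x y.
Proof.
elim=> [x y _ xy_max | O0 u _ [x [y [O' [-> xy_max]]]] _ _].
  by exists x, y, [::].
by exists x, y, (rcons O' u).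
Qed.

Section UpperBound.
Variables (b M : R).
Hypothesis b_lt1 : b < 1.
Hypothesis b_ge0 : 0 <= b.
Hypothesis p_le_b : forall x, p x <= b.
Hypothesis M_ge0 : 0 <= M.
Hypothesis pair_le : forall x y, x != y -> p x * p y * d x y <= M.

Lemma prefix_probD_le O k m : (k + m <= size O)%N ->
  prefix_prob p O (k + m) <= prefix_prob p O k * b ^+ m.
Proof.
elim: m => [|m IHm] ltkm; first by rewrite addn0 mulr1.
(* The length bound excludes the empty sequence; otherwise the head serves as default value for
   [nth]. *)
case: O => [|x0 O] in IHm ltkm *; first by rewrite addnS in ltkm.
rewrite addnS in ltkm *; rewrite (prefix_probS x0 ltkm) exprSr mulrA.
by apply: ler_pM => //; [exact: prefix_prob_ge0 | exact/IHm/ltnW].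
Qed.

(** The terms of the weight are dominated by a geometric progression of ratio [b] that starts at its
    first term. *)
Lemma ohp_weight_le O i : (i < size O)%N ->
  (1 - b) * ohp_weight p O i <= prefix_prob p O i.+1.
Proof.
move=> lti; rewrite /ohp_weight -{1}[i.+1]add0n big_addn big_mkord.
have le_geom : \sum_(j < (size O).+1 - i.+1) prefix_prob p O (j + i.+1)
    <= prefix_prob p O i.+1 * \sum_(j < (size O).+1 - i.+1) b ^+ j.
  rewrite mulr_sumr; apply: ler_sum => j _; rewrite addnC prefix_probD_le //.
  by rewrite -ltnS -ltn_subRL.
apply: le_trans (ler_wpM2l _ le_geom) _; first by rewrite subr_ge0 ltW.
by rewrite mulrCA ler_piMr ?prefix_prob_ge0 ?geometric_sum_le1.
Qed.

(** The first [i] factors contribute at most [b ^+ i]; the last two, together with the distance, are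
    the value of a pair, distinct by [uniq O]. *)
Lemma prefix_prob_dist_le O i : uniq O -> (i.+1 < size O)%N ->
  prefix_prob p O i.+2 * dist_at d O i.+1 i.+2 <= b ^+ i * M.
Proof.
case: O => // x0 O uO lti; set O1 := x0 :: O in uO lti *.
rewrite (prefix_probS x0 lti) (prefix_probS x0 (ltnW lti)) -!mulrA.
apply: ler_pM; rewrite ?prefix_prob_ge0 ?mulr_ge0 ?dist_at_ge0 //.
  have := @prefix_probD_le O1 0 i (ltnW (ltnW lti)).
  by rewrite add0n [prefix_prob p O1 0]big_nil mul1r.
rewrite mulrA; apply: pair_le.
by rewrite nth_uniq ?(ltnW lti) // neq_ltn ltnSn.
Qed.

(** One factor [1 - b] absorbs the tail inside each weight, the other the geometric sum over
    positions. *)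
Lemma ohp_le O : uniq O -> (1 - b) ^+ 2 * ohp d p O <= M.
Proof.
move=> uO; have b1 : 0 <= 1 - b by rewrite subr_ge0 ltW.
rewrite expr2 -mulrA /ohp big_add1 big_mkord.
have le_geom : (1 - b) *
    \sum_(i < (size O).-1) ohp_weight p O i.+1 * dist_at d O i.+1 i.+2
    <= (\sum_(i < (size O).-1) b ^+ i) * M.
  rewrite mulr_sumr mulr_suml; apply: ler_sum => i _.
  have lti : (i.+1 < size O)%N by rewrite -ltn_predRL.
  rewrite mulrA; apply: le_trans (prefix_prob_dist_le uO lti).
  by rewrite ler_wpM2r ?dist_at_ge0 ?ohp_weight_le.
apply: le_trans (ler_wpM2l b1 le_geom) _.
by rewrite mulrA ler_piMl ?geometric_sum_le1.
Qed.

End UpperBound.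
End FirstPair.

Theorem corollary3 (R : realType) (n : nat) (d : 'I_n -> 'I_n -> R)
    (p : 'I_n -> R) (a b : R)
    (n_ge2 : (2 <= n)%N)
    (d_ge0 : forall i j : 'I_n, 0 <= d i j)
    (d_sym : forall i j : 'I_n, d i j = d j i)
    (d_diag : forall i : 'I_n, d i i = 0)
    (a_gt0 : 0 < a) (a_le_b : a <= b) (b_lt1 : b < 1)
    (p_ab : forall i : 'I_n, a <= p i <= b)
    (O : seq 'I_n) (O_greedy : greedy_output d p O) :
  a ^+ 2 * (1 - b) ^+ 2 / (a ^+ 2 + b ^+ 2) * max_ohp d p <= ohp d p O.
Proof.
case: O_greedy => /greedy_run_first_pair[x [y [O' [-> xy_max]]]] _.
have b_ge0 : 0 <= b by exact: le_trans (ltW a_gt0) a_le_b.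
have p_ge0 i : 0 <= p i by have /andP[/(le_trans (ltW a_gt0))] := p_ab i.
have p_le_b i : p i <= b by have /andP[] := p_ab i.
apply: le_trans (first_pair_le_ohp d_ge0 p_ge0 x y O').
set M := p x * p y * d x y in xy_max *.
have M_ge0 : 0 <= M by rewrite !mulr_ge0.
have b1_gt0 : 0 < (1 - b) ^+ 2 by rewrite exprn_gt0 ?subr_gt0.
have ab_gt0 : 0 < a ^+ 2 + b ^+ 2.
  by rewrite ltr_wpDr ?exprn_ge0 ?exprn_gt0.
have max_le : max_ohp d p <= M / (1 - b) ^+ 2.
  have ohp_leM (s : seq 'I_n) : uniq s -> ohp d p s <= M / (1 - b) ^+ 2.
    by move=> us; rewrite ler_pdivlMr // mulrC; exact: ohp_le.
  (* The seed of the maximum must obey the bound too; it is itself an ordering. *)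
  by apply: bigmax_le => [|s us]; apply: ohp_leM; rewrite // enum_uniq.
have ratio_ge0 : 0 <= a ^+ 2 / (a ^+ 2 + b ^+ 2).
  by rewrite divr_ge0 ?exprn_ge0 ?ltW.
(* Regrouping pairs [(1 - b) ^+ 2] with the maximum, which gives at most [M]; the remaining ratio is
   at most 1. *)
rewrite [a ^+ 2 * _ / _]mulrAC -[_ * max_ohp _ _]mulrA.
apply: (@le_trans _ _ (a ^+ 2 / (a ^+ 2 + b ^+ 2) * M)).
  by rewrite ler_wpM2l // mulrC -ler_pdivlMr.
by rewrite ler_piMl // ler_pdivrMr // mul1r lerDl exprn_ge0.
Qed.
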